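(* Fix an integer $\Lambda \ge 2$, and let $G$ be a loopless series-parallel graph of maxmaxflow at most $\Lambda$. Then every root $q\in\mathbb{C}$ (real or complex) of the chromatic polynomial $P_G(q)$ satisfies $|q-1| < (\Lambda-1)/\log 2$.
   Context: Graphs are finite and undirected and may have loops and multiple edges. For a graph $G=(V,E)$, $q\in\mathbb{C}$ and edge weights $\mathbf v=(v_e)_{e\in E}$, the multivariate Tutte polynomial is $Z_G(q,\mathbf v)=\sum_{A\subseteq E} q^{k(A)}\prod_{e\in A} v_e$, where $k(A)$ is the number of connected components of the spanning subgraph $(V,A)$. The chromatic polynomial is $P_G(q)=Z_G(q,\mathbf v)$ with $v_e=-1$ for every edge. For distinct vertices $x,y$, $\lambda_G(x,y)$ denotes the maximum number of pairwise edge-disjoint paths from $x$ to $y$; the maxmaxflow of $G$ is $\Lambda(G)=\max_{x\neq y}\lambda_G(x,y)$ (taken to be $0$ if $G$ has fewer than two vertices). A loopless graph is series-parallel if it can be obtained from a forest by a finite (possibly empty) sequence of operations, each of which replaces an edge either by two edges in series (i.e. subdivides it with a new vertex of degree 2) or by two parallel edges with the same endpoints. *)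

(* Defs.v *)
From Stdlib Require Import Reals.
From mathcomp Require Import all_boot.

Set Implicit Arguments.
Unset Strict Implicit.
Unset Printing Implicit Defensive.

Definition Cx : Type := (R * R)%type.
Definition Czero : Cx := (R0, R0).
Definition Cone : Cx := (R1, R0).
Definition Cadd (z w : Cx) : Cx := (Rplus (fst z) (fst w), Rplus (snd z) (snd w)).
Definition Csub (z w : Cx) : Cx := (Rminus (fst z) (fst w), Rminus (snd z) (snd w)).
Definition Cmul (z w : Cx) : Cx :=
  (Rminus (Rmult (fst z) (fst w)) (Rmult (snd z) (snd w)),
   Rplus (Rmult (fst z) (snd w)) (Rmult (snd z) (fst w))).
Definition Cscale (r : R) (z : Cx) : Cx := (Rmult r (fst z), Rmult r (snd z)).
Fixpoint Cpow (z : Cx) (k : nat) : Cx :=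
  match k with O => Cone | S k' => Cmul z (Cpow z k') end.
Definition Cmod (z : Cx) : R := sqrt (Rplus (Rmult (fst z) (fst z)) (Rmult (snd z) (snd z))).

(* Vertices are 0, ..., nv-1; edges are listed (with multiplicity) as pairs of
   endpoints; edge number i is the i-th entry of the list. *)
Record mgraph := MGraph { nv : nat; edges : seq (nat * nat) }.

Definition ne (G : mgraph) : nat := size (edges G).

Definition wf_graph (G : mgraph) : bool :=
  all (fun e => (e.1 < nv G) && (e.2 < nv G)) (edges G).

Definition loopless (G : mgraph) : bool := all (fun e => e.1 != e.2) (edges G).

Definition joins (G : mgraph) (i u w : nat) : bool :=
  (i < ne G) &&
  (let e := nth (0, 0) (edges G) i in
   ((e.1 == u) && (e.2 == w)) || ((e.1 == w) && (e.2 == u))).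

Fixpoint walk_ok (G : mgraph) (vs : seq nat) (es : seq nat) : bool :=
  match vs, es with
  | [:: _], [::] => true
  | u :: ((w :: _) as vs'), i :: es' => joins G i u w && walk_ok G vs' es'
  | _, _ => false
  end.

Definition is_path (G : mgraph) (x y : nat) (vs es : seq nat) : bool :=
  [&& walk_ok G vs es, head x.+1 vs == x, last x.+1 vs == y & uniq vs].

Definition is_cycle (G : mgraph) (vs es : seq nat) : bool :=
  [&& walk_ok G (rcons vs (head 0 vs)) es, uniq vs, uniq es & 0 < size es].

Definition forest (G : mgraph) : Prop := forall vs es, ~~ is_cycle G vs es.

Definition maxmaxflow_le (G : mgraph) (L : nat) : Prop :=
  forall x y, x < nv G -> y < nv G -> x != y ->
  forall ps : seq (seq nat * seq nat),
    all (fun p => is_path G x y p.1 p.2) ps ->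
    uniq (flatten (map snd ps)) ->
    size ps <= L.

Definition subdivide (G : mgraph) (i : nat) : mgraph :=
  let e := nth (0, 0) (edges G) i in
  MGraph (nv G).+1 (rcons (set_nth (0, 0) (edges G) i (e.1, nv G)) (nv G, e.2)).

Definition duplicate (G : mgraph) (i : nat) : mgraph :=
  MGraph (nv G) (rcons (edges G) (nth (0, 0) (edges G) i)).

Definition normalize (e : nat * nat) : nat * nat := (minn e.1 e.2, maxn e.1 e.2).

Definition isomorphic (G H : mgraph) : Prop :=
  nv G = nv H /\
  exists f : nat -> nat,
    (forall x, x < nv G -> f x < nv H) /\
    (forall x y, x < nv G -> y < nv G -> f x = f y -> x = y) /\
    perm_eq (map (fun e => normalize (f e.1, f e.2)) (edges G))
            (map normalize (edges H)).

Inductive series_parallel : mgraph -> Prop :=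
| sp_forest G : wf_graph G -> loopless G -> forest G -> series_parallel G
| sp_series G i : series_parallel G -> i < ne G -> series_parallel (subdivide G i)
| sp_parallel G i : series_parallel G -> i < ne G -> series_parallel (duplicate G i)
| sp_iso G H : series_parallel G -> isomorphic G H -> series_parallel H.

(* ---------- Chromatic polynomial (Fortuin-Kasteleyn form) ---------- *)
Definition adjA (G : mgraph) (A : {set 'I_(ne G)}) : rel 'I_(nv G) :=
  fun x y => [exists i in A, joins G (nat_of_ord i) x y].

Definition ncomp (G : mgraph) (A : {set 'I_(ne G)}) : nat :=
  #|[set [set y | connect (adjA A) x y] | x : 'I_(nv G)]|.

Definition chrom (G : mgraph) (q : Cx) : Cx :=
  \big[Cadd/Czero]_(A : {set 'I_(ne G)}) Cscale (pow (Ropp R1) #|A|) (Cpow q (ncomp A)).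

(* Main.v *)
(* Put n = L - 1 and rho = |q - 1| >= n / ln 2.  Undoing the series and parallel operations one at a time turns G into a forest whose edges carry weights (a, b), a for an absent and b for a present edge.  In terms of the transmissivity t = b / (q a + b), a series reduction multiplies transmissivities, while a parallel reduction multiplies the ratios (a + b) / a = (1 + (q - 1) t) / (1 - t).  An original edge has a + b = 0 and |t| = 1 / rho.

   The invariant is that an edge lying on a cycle consists of m parallel pieces, where each piece is an original edge or has |t| <= 1 / rho^2, and where m edge-disjoint routes of G join its ends.  As an edge on a cycle has one more route through the rest of the graph, m <= n.  The inequality (1 + s)^(m+1) <= 2 (1 + s^2)^m with s = 1 / rho and m s <= ln 2 then gives |t| <= 1 / rho for the whole edge, so that a series reduction again yields a piece with |t| <= 1 / rho^2.  When a parallel reduction creates a bridge, m <= n + 1 still ensures q a + b <> 0, and for the final forest the Tutte polynomial is a power of q times the product of the factors q a + b. *)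
Require Import Defs.
From HB Require Import structures.
From Stdlib Require Import Reals Lra Lia Relations Permutation.
From Coquelicot Require Import Coquelicot.
From mathcomp Require Import all_boot.

Set Implicit Arguments.
Unset Strict Implicit.
Unset Printing Implicit Defensive.

Delimit Scope R_scope with R.
Local Open Scope nat_scope.

(** * Estimates *)

Section Reals.
Local Open Scope R_scope.

Lemma incr_from_0 (f f' : R -> R) (x : R) : 0 <= x ->
  (forall y, 0 <= y <= x -> derivable_pt_lim f y (f' y)) ->
  (forall y, 0 <= y <= x -> 0 <= f' y) -> f 0 <= f x.
Proof.
move=> x0 df f'0; case: (Rle_lt_or_eq_dec _ _ x0) => [xp|<-]; last by lra.
have [c [e c0x]] := MVT_cor2 f f' 0 x xp df.
have := f'0 c ltac:(lra); nra.
Qed.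

Lemma ln_1p_le (x : R) : 0 <= x -> ln (1 + x) <= x - x ^ 2 / 2 + x ^ 3 / 3.
Proof.
move=> x0.
have := @incr_from_0 (fun y => y - y ^ 2 / 2 + y ^ 3 / 3 - ln (1 + y))
  (fun y => y ^ 3 / (1 + y)) x x0.
rewrite Rplus_0_r ln_1 => H; suff: 0 - 0 ^ 2 / 2 + 0 ^ 3 / 3 - 0 <= x - x ^ 2 / 2 + x ^ 3 / 3 - ln (1 + x) by lra.
apply: H => y y0.
  by apply/is_derive_Reals; auto_derive; [lra | field; lra].
apply: Rmult_le_pos; first by apply: pow_le; lra.
by left; apply: Rinv_0_lt_compat; lra.
Qed.

Lemma ln_1p_ge (x : R) : 0 <= x -> x - x ^ 2 / 2 <= ln (1 + x).
Proof.
move=> x0.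
have := @incr_from_0 (fun y => ln (1 + y) - (y - y ^ 2 / 2))
  (fun y => y ^ 2 / (1 + y)) x x0.
rewrite Rplus_0_r ln_1 => H; suff: 0 - (0 - 0 ^ 2 / 2) <= ln (1 + x) - (x - x ^ 2 / 2) by lra.
apply: H => y y0.
  by apply/is_derive_Reals; auto_derive; [lra | field; lra].
apply: Rmult_le_pos; first by apply: pow_le; lra.
by left; apply: Rinv_0_lt_compat; lra.
Qed.

(** Both bounds come from powers of [1 + x <= exp x]: [(1 + 1/5)^4 >= 2] and
    [(1 - 17/800)^32 >= 1/2]. The lower bound must exceed [2/3] for the next estimate. *)
Lemma ln2_bounds : 68 / 100 <= ln 2 <= 8 / 10.
Proof.
have e1 := exp_ineq1_le (2 / 10); have e2 := exp_ineq1_le (- (68 / 3200)).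
have p k x : exp (INR k * x) = exp x ^ k by rewrite Rmult_comm -Rpower_pow ?/Rpower ?ln_exp 1?Rmult_comm //; apply: exp_pos.
have h1 : 2 <= exp (8 / 10).
  have -> : 8 / 10 = INR 4 * (2 / 10) by simpl; lra.
  rewrite p; apply: Rle_trans (pow_incr (1 + 2 / 10) _ 4 _); lra.
have h2 : 1 / 2 <= exp (- (68 / 100)).
  have -> : - (68 / 100) = INR 32 * (- (68 / 3200)) by simpl; lra.
  rewrite p; apply: Rle_trans (pow_incr (1 + - (68 / 3200)) _ 32 _); lra.
rewrite exp_Ropp in h2; have ep := exp_pos (68 / 100).
have h3 : exp (68 / 100) <= 2.
  have : exp (68 / 100) * / exp (68 / 100) = 1 by field; lra.
  nra.
split; [rewrite -(ln_exp (68 / 100)) | rewrite -(ln_exp (8 / 10))].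
  by apply: ln_le.
by apply: ln_le; lra.
Qed.

(** For [m >= 2] the hypothesis forces [s <= 2/5], and the logarithms can be compared through the
    Taylor bounds above. For [m = 0] and [m = 1] it leaves [s] too large for that, but the
    inequality is then elementary. *)
Lemma pow_ratio_le2 (m : nat) (s : R) : 0 < s <= 1 -> INR m * s <= ln 2 ->
  (1 + s) ^ m.+1 <= 2 * (1 + s ^ 2) ^ m.
Proof.
move=> [s0 s1] ms; have [l1 l2] := ln2_bounds.
case: m ms => [|[|m]] ms.
- by simpl; lra.
- by simpl; nra.
have m2 : INR 2 <= INR m.+2 by apply: le_INR; lia.
move: m.+2 m2 ms => {}m m2 ms.
rewrite [INR 2]/= in m2.
have a0 : 0 < (1 + s) ^ m.+1 by apply: pow_lt; lra.
have b0 : 0 < (1 + s ^ 2) ^ m by apply: pow_lt; nra.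
have c0 : 0 < 2 * (1 + s ^ 2) ^ m by lra.
apply: Rnot_lt_le => /(ln_increasing _ _ c0); apply: Rle_not_lt.
rewrite ln_mult // ?ln_pow; try (simpl; nra).
have u := ln_1p_le (Rlt_le _ _ s0); have v := @ln_1p_ge (s ^ 2) ltac:(nra).
rewrite S_INR.
set x := INR m in m2 ms *.
have s4 : s <= 4 / 10 by nra.
have w : 0 <= s - s ^ 2 / 2 + s ^ 3 / 3 - (s ^ 2 - (s ^ 2) ^ 2 / 2).
  have -> : s - s ^ 2 / 2 + s ^ 3 / 3 - (s ^ 2 - (s ^ 2) ^ 2 / 2) =
            s * (1 - 3 / 2 * s + s ^ 2 / 3 + s ^ 3 / 2) by field.
  by apply: Rmult_le_pos; [lra | nra].
apply: (Rle_trans _ ((x + 1) * (s - s ^ 2 / 2 + s ^ 3 / 3))); first by apply: Rmult_le_compat_l; lra.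
apply: (Rle_trans _ (ln 2 + x * (s ^ 2 - (s ^ 2) ^ 2 / 2))); last first.
  by apply: Rplus_le_compat_l; apply: Rmult_le_compat_l; lra.
(* The terms are regrouped so that [x * s], which is at most [ln 2], multiplies a single nonnegative
   cofactor. *)
have -> : (x + 1) * (s - s ^ 2 / 2 + s ^ 3 / 3) =
   x * s * (1 - 3 / 2 * s + s ^ 2 / 3 + s ^ 3 / 2) + (s - s ^ 2 / 2 + s ^ 3 / 3) +
   x * (s ^ 2 - (s ^ 2) ^ 2 / 2) by field.
have g0 : 0 <= 1 - 3 / 2 * s + s ^ 2 / 3 + s ^ 3 / 2 by nra.
have := Rmult_le_compat_r _ _ _ g0 ms.
(* This is what remains once [x * s] is replaced by [ln 2] and a factor [s] is divided out; at
   [s = 0] it reads [1 <= 3/2 * ln 2]. *)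
have : 1 - s / 2 + s ^ 2 / 3 <= ln 2 * (3 / 2 - s / 3 - s ^ 2 / 2).
  apply: (Rle_trans _ (68 / 100 * (3 / 2 - s / 3 - s ^ 2 / 2))); first by nra.
  by apply: Rmult_le_compat_r; nra.
move=> /(Rmult_le_compat_l s _ _ (Rlt_le _ _ s0)); lra.
Qed.
End Reals.

(** * Transmissivities of parallel and series connections *)

Section Pieces.
Local Open Scope R_scope.
Local Open Scope C_scope.
Variables (q : C) (n : nat).
Let rho : R := Cmod (q - 1).
Hypothesis n_gt0 : (0 < n)%N.
Hypothesis rho_ge : (INR n <= rho * ln 2)%R.

Definition cprod (f : C -> C) (ts : seq C) : C := foldr (fun t p => f t * p) 1 ts.

(** If [t = b / (q a + b)], then [1 - t = q a / (q a + b)] and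
    [1 + (q - 1) t = q (a + b) / (q a + b)]. Up to a common factor, the two products are thus the
    weights [a] and [a + b] of a parallel connection. *)
Let prodX := cprod (fun t => 1 - t).
Let prodY := cprod (fun t => 1 + (q - 1) * t).

Definition small (t : C) : Prop := (Cmod t * rho ^ 2 <= 1)%R.

Fixpoint all_small (ts : seq C) : Prop :=
  if ts is t :: ts' then small t /\ all_small ts' else True.

Lemma cprod_cat f s t : cprod f (s ++ t) = cprod f s * cprod f t.
Proof. by elim: s => [|x s /= ->]; rewrite /=; ring. Qed.

Lemma all_small_cat s t : all_small s -> all_small t -> all_small (s ++ t).
Proof. by elim: s => [|x s IH] //= [xs ss] ts; split=> //; apply: IH. Qed.

Lemma rho_gt1 : (1 < rho)%R.
Proof.
have [l1 l2] := ln2_bounds.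
have : (1 <= INR n)%R by apply: (le_INR 1); apply/leP.
nra.
Qed.

Lemma q_neq0 : q <> 0.
Proof.
move=> q0; have := rho_gt1; rewrite /rho q0.
have -> : 0 - 1 = - (1 : C) by ring.
by rewrite Cmod_opp Cmod_1; lra.
Qed.

Lemma small_lt1 t : small t -> (Cmod t < 1)%R.
Proof. have r1 := rho_gt1; have := Cmod_ge_0 t; rewrite /small; nra. Qed.

Lemma prodX_neq0 ts : all_small ts -> prodX ts <> 0.
Proof.
elim: ts => [_|t ts IH /= [/small_lt1 ht /IH h]].
  by move=> /RtoC_inj; lra.
apply: Cmult_neq_0 => // h1.
have t1 : t = 1 by rewrite -[t]Cplus_0_r -h1; ring.
by move: ht; rewrite t1 Cmod_1; lra.
Qed.

(** These are the values of [prodY] and [prodX] for [m] pieces in the extremal case [q - 1 = - rho],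
    all [t = - 1 / rho^2]. The next three bounds are equalities there. *)
Let A (m : nat) : R := ((1 + / rho) ^ m)%R.
Let B (m : nat) : R := ((1 + / rho ^ 2) ^ m)%R.

(** The difference is [q = (q - 1) - (-1)] times a sum of products of powers, bounded by a geometric
    sum in [rho]. Keeping the exact factor [Cmod q] lets it cancel in the later comparisons. *)
Lemma Cmod_sub_pow_le (j : nat) :
  (Cmod ((q - 1) ^ j - (- (1)) ^ j) <= Cmod q * ((rho ^ j - 1) / (rho - 1)))%R.
Proof.
have r1 := rho_gt1; have q0 := Cmod_ge_0 q.
elim: j => [|j IH].
  rewrite /= (_ : 1 - 1 = 0); last by ring.
  by rewrite Cmod_0; apply: Req_le; field; lra.
have -> : (q - 1) ^ j.+1 - (- (1)) ^ j.+1 =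
    (q - 1) * ((q - 1) ^ j - (- (1)) ^ j) + q * (- (1)) ^ j by rewrite !Cpow_S; ring.
apply: Rle_trans (Cmod_triangle _ _) _; rewrite !Cmod_mult -/rho.
have -> : Cmod ((- (1)) ^ j) = 1%R by rewrite Cmod_pow Cmod_opp Cmod_1 pow1.
have -> : (Cmod q * ((rho ^ j.+1 - 1) / (rho - 1)) =
  rho * (Cmod q * ((rho ^ j - 1) / (rho - 1))) + Cmod q * 1)%R by rewrite /=; field; lra.
apply: Rplus_le_compat_r; apply: Rmult_le_compat_l IH; lra.
Qed.

(* Carrying all exponents [j] makes the induction on [ts] close, since a new factor shifts [j] by one; only [j = 0] is needed. *)
Lemma Cmod_sub_prod_le (ts : seq C) (j : nat) : all_small ts ->
  (Cmod ((q - 1) ^ j * prodY ts - (- (1)) ^ j * prodX ts) <=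
   Cmod q * ((rho ^ j * A (size ts) - B (size ts)) / (rho - 1)))%R.
Proof.
have r1 := rho_gt1; have q0 := Cmod_ge_0 q.
elim: ts j => [|t ts IH] j /=.
  by move=> _; rewrite !Cmult_1_r /A /B /= Rmult_1_r; apply: Cmod_sub_pow_le.
move=> [st /[dup] /(IH j) h1 /(IH j.+1) h2].
have -> : (q - 1) ^ j * ((1 + (q - 1) * t) * prodY ts) - (- (1)) ^ j * ((1 - t) * prodX ts) =
  ((q - 1) ^ j * prodY ts - (- (1)) ^ j * prodX ts) +
  t * ((q - 1) ^ j.+1 * prodY ts - (- (1)) ^ j.+1 * prodX ts) by rewrite !Cpow_S; ring.
apply: Rle_trans (Cmod_triangle _ _) _; rewrite Cmod_mult.
have -> : (Cmod q * ((rho ^ j * A (size ts).+1 - B (size ts).+1) / (rho - 1)) =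
  Cmod q * ((rho ^ j * A (size ts) - B (size ts)) / (rho - 1)) +
  / rho ^ 2 * (Cmod q * ((rho ^ j.+1 * A (size ts) - B (size ts)) / (rho - 1))))%R.
  by rewrite /A /B /=; field; lra.
apply: Rplus_le_compat => //.
apply: Rmult_le_compat h2; try apply: Cmod_ge_0.
apply: (Rmult_le_reg_r (rho ^ 2)); first nra.
by rewrite Rinv_l; [exact: st | nra].
Qed.

(** Up to scale, [prodY + (q - 1) * prodX] is the denominator [q a + b], and it equals [q] when
    there are no pieces. Each further piece changes it by [(q - 1) * t * (prodY - prodX)], which the
    previous lemma bounds. *)
Lemma Cmod_add_prod_le (ts : seq C) : all_small ts ->
  (Cmod (prodY ts + (q - 1) * prodX ts - q) <=
   Cmod q * ((A (size ts) - rho * B (size ts)) / (rho - 1) + 1))%R.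
Proof.
have r1 := rho_gt1; have q0 := Cmod_ge_0 q.
elim: ts => [_|t ts IH /= [st ss]].
  rewrite /= (_ : 1 + (q - 1) * 1 - q = 0); last by ring.
  by rewrite Cmod_0 /A /B /=; apply: Req_le; field; lra.
have -> : (1 + (q - 1) * t) * prodY ts + (q - 1) * ((1 - t) * prodX ts) - q =
  (prodY ts + (q - 1) * prodX ts - q) +
  ((q - 1) * t) * ((q - 1) ^ 0 * prodY ts - (- (1)) ^ 0 * prodX ts) by rewrite /=; ring.
apply: Rle_trans (Cmod_triangle _ _) _; rewrite Cmod_mult.
have -> : (Cmod q * ((A (size ts).+1 - rho * B (size ts).+1) / (rho - 1) + 1) =
  Cmod q * ((A (size ts) - rho * B (size ts)) / (rho - 1) + 1) +
  / rho * (Cmod q * ((rho ^ 0 * A (size ts) - B (size ts)) / (rho - 1))))%R.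
  by rewrite /A /B /=; field; lra.
apply: Rplus_le_compat; first exact: IH.
apply: Rmult_le_compat (Cmod_sub_prod_le _ ss); try apply: Cmod_ge_0.
rewrite Cmod_mult -/rho; apply: (Rmult_le_reg_r rho); first lra.
rewrite Rinv_l; last lra.
by move: st; rewrite /small /=; lra.
Qed.

Lemma A_le_2B (m : nat) : (m <= n)%N -> (A m.+1 <= 2 * B m)%R.
Proof.
move=> mn; have r1 := rho_gt1.
rewrite /A /B -pow_inv; apply: pow_ratio_le2.
  split; first by apply: Rinv_0_lt_compat; lra.
  by rewrite -Rinv_1; apply: Rinv_le_contravar; lra.
apply: (Rmult_le_reg_r rho); first lra.
rewrite Rmult_assoc Rinv_l; last lra.
have : (INR m <= INR n)%R by apply: le_INR; apply/leP.
lra.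
Qed.

(** The denominator has modulus at least [|q| (rho B - A) / (rho - 1)]. This is positive because [A
    m.+1 <= 2 * B m < (rho + / rho) * B m = rho * B m.+1]. *)
Lemma prod_denominator_gt0 (ts : seq C) : (size ts <= n.+1)%N -> all_small ts ->
  (0 < Cmod (prodY ts + (q - 1) * prodX ts))%R.
Proof.
move=> sz /Cmod_add_prod_le; have r1 := rho_gt1.
have q0 : (0 < Cmod q)%R by apply/Cmod_gt_0/q_neq0.
have b1 : (1 <= B (size ts))%R.
  by apply: pow_R1_Rle; have := Rinv_0_lt_compat (rho ^ 2) ltac:(nra); lra.
have ab : (A (size ts) < rho * B (size ts))%R.
  case: (size ts) sz b1 => [|m] mn b1; first by rewrite /A /B /=; lra.
  apply: Rle_lt_trans (A_le_2B mn) _.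
  have -> : (rho * B m.+1 = (rho + / rho) * B m)%R by rewrite /B /=; field; lra.
  apply: Rmult_lt_compat_r; first by apply: pow_lt; have := Rinv_0_lt_compat (rho ^ 2) ltac:(nra); lra.
  have := Rinv_r rho ltac:(lra); have := Rinv_0_lt_compat rho ltac:(lra); nra.
set D := prodY ts + _ => h.
have := Cmod_triangle (- (D - q)) D; rewrite Cmod_opp (_ : - (D - q) + D = q); last by ring.
have c : ((A (size ts) - rho * B (size ts)) / (rho - 1) < 0)%R.
  by apply: Rmult_neg_pos; [lra | apply: Rinv_0_lt_compat; lra].
nra.
Qed.

(** Bounding the numerator above and the denominator below reduces the claim to
    [rho (A - B) <= rho B - A], that is [(rho + 1) A <= 2 rho B], which is [A_le_2B] multiplied by
    [rho]. *)
Lemma prod_ratio_le (ts : seq C) : (size ts <= n)%N -> all_small ts ->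
  (Cmod (prodY ts - prodX ts) * rho <= Cmod (prodY ts + (q - 1) * prodX ts))%R.
Proof.
move=> sz ss; have r1 := rho_gt1.
have h1 := Cmod_sub_prod_le 0 ss; have h2 := Cmod_add_prod_le ss.
rewrite !Cmult_1_l in h1.
set D := prodY ts + _ in h2 *.
have h3 := Cmod_triangle (- (D - q)) D; rewrite Cmod_opp (_ : - (D - q) + D = q) in h3; last by ring.
apply: (Rle_trans _ (Cmod q * ((rho ^ 0 * A (size ts) - B (size ts)) / (rho - 1)) * rho)).
  by apply: Rmult_le_compat_r; lra.
have ab : ((rho + 1) * A (size ts) <= 2 * rho * B (size ts))%R.
  have := A_le_2B sz; rewrite {1}/A /= -/(A _) => h.
  have := Rmult_le_compat_l rho _ _ ltac:(lra) h.
  have -> : (rho * ((1 + / rho) * A (size ts)) = (rho + 1) * A (size ts))%R by field; lra.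
  lra.
suff : (Cmod q * ((rho ^ 0 * A (size ts) - B (size ts)) / (rho - 1)) * rho <=
  Cmod q - Cmod q * ((A (size ts) - rho * B (size ts)) / (rho - 1) + 1))%R by lra.
suff : (0 <= Cmod q * ((2 * rho * B (size ts) - (rho + 1) * A (size ts)) / (rho - 1)))%R.
  move=> h; apply: (Rplus_le_reg_r (- (Cmod q * ((rho ^ 0 * A (size ts) - B (size ts)) / (rho - 1)) * rho))).
  rewrite Rplus_opp_r; apply: Rle_trans h _; apply: Req_le; rewrite /=; field; lra.
apply: Rmult_le_pos; first exact: Cmod_ge_0.
by apply: Rmult_le_pos; [lra | left; apply: Rinv_0_lt_compat; lra].
Qed.

(* An edge of weight [a] (absent) or [b] (present) has transmissivity [b / (q a + b)].  It stands for [m] parallel pieces, each of transmissivity [t] with [small t], unless one of them is a genuine edge of the graph, which forces [a + b = 0]. *)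
Definition parallel_pieces (m : nat) (a b : C) : Prop :=
  (a <> 0 /\ a + b = 0) \/
  exists ts (k : C), [/\ size ts = m, all_small ts, k <> 0,
    a = k * prodX ts & a + b = k * prodY ts].

Lemma parallel_pieces_edge m : parallel_pieces m 1 (- (1)).
Proof. by left; split; [by move=> /RtoC_inj; lra | ring]. Qed.

Lemma parallel_pieces_neq0 m a b : parallel_pieces m a b -> a <> 0.
Proof.
case=> [[]//|[ts [k [_ ss k0 -> _]]]].
exact: Cmult_neq_0 k0 (prodX_neq0 ss).
Qed.

(** Both [a] and [a + b] are multiplicative under parallel connection, so the lists of
    transmissivities concatenate, and a vanishing [a + b] persists. *)
Lemma parallel_pieces_mul m1 m2 a1 b1 a2 b2 :
  parallel_pieces m1 a1 b1 -> parallel_pieces m2 a2 b2 ->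
  parallel_pieces (m1 + m2) (a1 * a2) (a1 * b2 + b1 * a2 + b1 * b2).
Proof.
move=> p1 p2; have e : a1 * a2 + (a1 * b2 + b1 * a2 + b1 * b2) = (a1 + b1) * (a2 + b2) by ring.
have a0 : a1 * a2 <> 0 by apply: Cmult_neq_0; [apply: parallel_pieces_neq0 p1 | apply: parallel_pieces_neq0 p2].
case: p1 => [[_ s1]|[ts1 [k1 [z1 ss1 k10 e1 f1]]]].
  by left; split=> //; rewrite e s1; ring.
case: p2 => [[_ s2]|[ts2 [k2 [z2 ss2 k20 e2 f2]]]].
  by left; split=> //; rewrite e s2; ring.
right; exists (ts1 ++ ts2), (k1 * k2); split.
- by rewrite size_cat z1 z2.
- exact: all_small_cat.
- exact: Cmult_neq_0.
- by rewrite /prodX cprod_cat e1 e2 /prodX; ring.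
- by rewrite e f1 f2 /prodY cprod_cat; ring.
Qed.

Lemma parallel_pieces_bound m a b : (m <= n)%N -> parallel_pieces m a b ->
  (Cmod b * rho <= Cmod (q * a + b))%R.
Proof.
move=> mn [[a0 ab]|[ts [k [sz ss k0 ea eab]]]].
  (* When [a + b = 0] the denominator is [(q - 1) * a], and the bound is an equality. *)
  have -> : b = - a by rewrite -[b]Cplus_0_r -(Cplus_opp_r a) Cplus_assoc [b + a]Cplus_comm ab; ring.
  rewrite Cmod_opp (_ : q * a + - a = (q - 1) * a); last by ring.
  by rewrite Cmod_mult -/rho; lra.
have -> : q * a + b = k * (prodY ts + (q - 1) * prodX ts).
  by transitivity ((a + b) + (q - 1) * a); [ring | rewrite eab ea; ring].
have -> : b = k * (prodY ts - prodX ts).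
  by transitivity ((a + b) - a); [ring | rewrite eab ea; ring].
rewrite !Cmod_mult Rmult_assoc; apply: Rmult_le_compat_l; first exact: Cmod_ge_0.
by apply: prod_ratio_le; rewrite ?sz.
Qed.

Lemma parallel_pieces_denominator m a b : (m <= n.+1)%N -> parallel_pieces m a b ->
  q * a + b <> 0.
Proof.
move=> mn [[a0 ab]|[ts [k [sz ss k0 ea eab]]]].
  rewrite (_ : q * a + b = (a + b) + (q - 1) * a); last by ring.
  rewrite ab Cplus_0_l; apply: Cmult_neq_0 => //; apply/Cmod_gt_0; rewrite -/rho.
  by have := rho_gt1; lra.
have -> : q * a + b = k * (prodY ts + (q - 1) * prodX ts).
  by transitivity ((a + b) + (q - 1) * a); [ring | rewrite eab ea; ring].
by apply: Cmult_neq_0 => //; apply/Cmod_gt_0/prod_denominator_gt0; rewrite ?sz.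
Qed.

Lemma parallel_pieces_series a1 b1 a2 b2 :
  q * a1 + b1 <> 0 -> q * a2 + b2 <> 0 ->
  (Cmod b1 * rho <= Cmod (q * a1 + b1))%R -> (Cmod b2 * rho <= Cmod (q * a2 + b2))%R ->
  parallel_pieces 1 (q * a1 * a2 + a1 * b2 + b1 * a2) (b1 * b2).
Proof.
move=> d1 d2 h1 h2; have q0 := q_neq0; have r1 := rho_gt1.
(* The single piece is the product of the two transmissivities. For the combined weights [q a + b]
   is the product of the old denominators, and [1 - t = q a / (q a + b)] dictates the scalar. *)
right; exists [:: b1 * b2 / ((q * a1 + b1) * (q * a2 + b2))], ((q * a1 + b1) * (q * a2 + b2) / q).
split=> //=.
- split=> //; rewrite /small Cmod_div; last exact: Cmult_neq_0.
  rewrite !Cmod_mult.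
  move: (proj1 (Cmod_gt_0 _) d1) (proj1 (Cmod_gt_0 _) d2) (Cmod_ge_0 b1) (Cmod_ge_0 b2) h1 h2.
  move: (Cmod (q * a1 + b1)) (Cmod (q * a2 + b2)) (Cmod b1) (Cmod b2) => u v x y u0 v0 x0 y0 h1 h2.
  apply: (Rmult_le_reg_r (u * v)); first nra.
  have -> : (x * y / (u * v) * rho ^ 2 * (u * v) = (x * rho) * (y * rho))%R by field; lra.
  by rewrite Rmult_1_l; apply: Rmult_le_compat => //; nra.
- apply: Cmult_neq_0; first exact: Cmult_neq_0.
  by apply/Cmod_gt_0; rewrite Cmod_inv //; apply: Rinv_0_lt_compat; apply/Cmod_gt_0.
- by field.
- by field.
Qed.

End Pieces.

(** * Deletion and contraction *)

(* An edge of the partially reduced graph: [absent] and [present] are its weights, and [routes] lists pairwise disjoint sets of edge numbers of the original graph, each of which connects the two ends. *)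
Record wedge := WEdge {
  ends : nat * nat; absent : C; present : C; routes : seq (seq nat) }.

Definition contract (r : nat -> nat) (e : nat * nat) : nat -> nat :=
  fun z => if r z == r e.2 then r e.1 else r z.

(** Only the fibres of a map matter to [Zsum], and only on the vertices that occur, so maps are
    compared through their kernels on [V]. *)
Definition agree (V : pred nat) (r r' : nat -> nat) : Prop :=
  {in V &, forall x y, (r x == r y) = (r' x == r' y)}.

Definition ends_in (V : pred nat) (ls : seq wedge) : bool :=
  all (fun l => ((ends l).1 \in V) && ((ends l).2 \in V)) ls.

Section WeightedZ.
Variable q : C.

(* Deletion-contraction form of the multivariate Tutte polynomial; vertices with equal image under [r] are identified. *)
Fixpoint Zsum (vs : seq nat) (r : nat -> nat) (ls : seq wedge) : C :=
  if ls is l :: ls' then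
    Cplus (Cmult (absent l) (Zsum vs r ls'))
          (Cmult (present l) (Zsum vs (contract r (ends l)) ls'))
  else (q ^ size (undup (map r vs)))%C.

Lemma contract_eq r e x y :
  (contract r e x == contract r e y) =
  [|| r x == r y, (r x == r e.1) && (r y == r e.2) | (r x == r e.2) && (r y == r e.1)].
Proof.
rewrite /contract; case: (altP (r x =P r e.2)) => [->|nx]; case: (altP (r y =P r e.2)) => [->|ny].
- by rewrite !eqxx.
- by rewrite andbF /= [r e.1 == r y]eq_sym [r e.2 == r y]eq_sym (negbTE ny).
- by rewrite andbT orbF (negbTE nx).
- by rewrite andbF orbF.
Qed.

Lemma contract_normalize r e x y :
  (contract r (normalize e) x == contract r (normalize e) y) = (contract r e x == contract r e y).
Proof.
rewrite !contract_eq /normalize /=; case: (leqP e.1 e.2) => _ //.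
by rewrite [in RHS]orbCA orbA orbC orbA [_ || (r x == r y)]orbC -orbA.
Qed.

Lemma agree_contract V r r' e : e.1 \in V -> e.2 \in V ->
  agree V r r' -> agree V (contract r e) (contract r' e).
Proof. by move=> h1 h2 h x y xV yV; rewrite !contract_eq !h. Qed.

Lemma size_undup_agree V r r' vs : {subset vs <= V} -> agree V r r' ->
  size (undup (map r vs)) = size (undup (map r' vs)).
Proof.
elim: vs => //= v vs IH sub h.
have sub' : {subset vs <= V} by move=> x xs; apply: sub; rewrite inE xs orbT.
have -> : (r v \in map r vs) = (r' v \in map r' vs).
  have vV : v \in V by apply: sub; rewrite mem_head.
  by apply/mapP/mapP => -[x xs /eqP e]; exists x => //; apply/eqP; move: e; rewrite h // sub'.
by case: ifP => _ /=; rewrite IH.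
Qed.

Lemma Zsum_agree V vs r r' ls : {subset vs <= V} -> ends_in V ls ->
  agree V r r' -> Zsum vs r ls = Zsum vs r' ls.
Proof.
move=> sub; elim: ls r r' => [|l ls IH] r r' /=.
  by move=> _ /(size_undup_agree sub) ->.
move=> /andP[/andP[h1 h2] h] a; rewrite (IH _ _ h a).
by rewrite (IH _ _ h (agree_contract h1 h2 a)).
Qed.

Lemma ends_inT ls : ends_in predT ls.
Proof. by elim: ls. Qed.

Lemma Zsum_eqker vs r r' ls : (forall x y, (r x == r y) = (r' x == r' y)) ->
  Zsum vs r ls = Zsum vs r' ls.
Proof. by move=> h; apply: (@Zsum_agree predT) (ends_inT _) _ => // x y _ _. Qed.

Lemma Zsum_cons vs r l ls e : ends l = normalize e ->
  Zsum vs r (l :: ls) = Cplus (Cmult (absent l) (Zsum vs r ls))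
    (Cmult (present l) (Zsum vs (contract r e) ls)).
Proof. by move=> /= ->; rewrite (Zsum_eqker _ _ (contract_normalize r e)). Qed.

Lemma Zsum_perm_vertices vs vs' r ls : perm_eq vs vs' -> Zsum vs r ls = Zsum vs' r ls.
Proof.
move=> p; elim: ls r => [|l ls IH] r /=; last by rewrite !IH.
by congr Cpow; apply/perm_size/perm_undup/perm_mem/perm_map.
Qed.

(** This is the universal property of contraction: it gives the finest partition coarser than [r]
    that joins the ends of [e]. Commutation of contractions follows from it formally. *)
Lemma contract_least (r : nat -> nat) e (r' : nat -> nat) x y :
  (forall u v, r u = r v -> r' u = r' v) -> r' e.1 = r' e.2 ->
  contract r e x = contract r e y -> r' x = r' y.
Proof.
move=> h he /eqP; rewrite contract_eq.
by case/or3P => [/eqP/h|/andP[/eqP/h -> /eqP/h ->]|/andP[/eqP/h -> /eqP/h ->]].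
Qed.

Lemma contract_coarser (r : nat -> nat) e x y : r x = r y -> contract r e x = contract r e y.
Proof. by rewrite /contract => ->. Qed.

Lemma contract_ends r e : contract r e e.1 = contract r e e.2.
Proof. by apply/eqP; rewrite contract_eq !eqxx orbT. Qed.

Lemma contractC r e f x y :
  contract (contract r e) f x = contract (contract r e) f y ->
  contract (contract r f) e x = contract (contract r f) e y.
Proof.
apply: contract_least; last by apply: contract_coarser; exact: contract_ends.
move=> u v; apply: contract_least; last exact: contract_ends.
by move=> {}u {}v h; do 2 apply: contract_coarser.
Qed.

Lemma Zsum_Permutation vs r ls ls' : Permutation ls ls' -> Zsum vs r ls = Zsum vs r ls'.
Proof.
move=> p; elim: p r => //= [l s s' _ IH r|l l' s r|s s' s'' _ IH1 _ IH2 r].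
- by rewrite !IH.
- rewrite (@Zsum_eqker _ (contract (contract r (ends l)) (ends l')) (contract (contract r (ends l')) (ends l))); first ring.
  by move=> x y; apply/eqP/eqP; apply: contractC.
- by rewrite IH1 IH2.
Qed.

Lemma Zsum_isolated (w : nat) (vs : seq nat) r ls : w \notin vs -> ends_in (predC1 w) ls ->
  (forall x, x != w -> r x != r w) -> Zsum (w :: vs) r ls = Cmult q (Zsum vs r ls).
Proof.
move=> wvs; elim: ls r => [r _ h|l ls IH r].
  rewrite /=; case: ifP => [/mapP[x xs e]|_ //].
  have /h : x != w by apply: contraNneq wvs => <-.
  by rewrite e eqxx.
rewrite [ends_in _ _]/= !inE => /andP[/andP[h1 h2] es] h /=.
rewrite !IH //; first ring.
move=> x xw; rewrite contract_eq (negbTE (h _ xw)) [r w == _]eq_sym (negbTE (h _ h2)).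
by rewrite [r w == _]eq_sym (negbTE (h _ h1)) !andbF.
Qed.

Lemma Zsum_attached (w : nat) (vs : seq nat) r ls x : x \in vs -> r x = r w ->
  Zsum (w :: vs) r ls = Zsum vs r ls.
Proof.
move=> xs; elim: ls r => [|l ls IH] r h /=.
  by rewrite ifT // -h map_f.
by rewrite !IH //; apply: contract_coarser.
Qed.

Lemma Zsum_parallel vs r l1 l2 l ls : ends l1 = ends l2 -> ends l = ends l1 ->
  absent l = (absent l1 * absent l2)%C ->
  present l = (absent l1 * present l2 + present l1 * absent l2 + present l1 * present l2)%C ->
  Zsum vs r (l1 :: l2 :: ls) = Zsum vs r (l :: ls).
Proof.
move=> /= -> -> -> ->.
rewrite (@Zsum_eqker _ (contract (contract r (ends l2)) (ends l2)) (contract r (ends l2))); first ring.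
move=> x y; rewrite contract_eq contract_ends orbb; case: eqP => //= h.
by apply/negP => /andP[/eqP ex /eqP ey]; apply: h; rewrite ex ey.
Qed.

(** The states of the two edges at [w] are expanded. With both absent [w] is isolated and
    contributes [q]; with one present [w] is absorbed into an end; with both present [x] and [y] are
    identified. *)
Lemma Zsum_series (vs : seq nat) (w x y : nat) l1 l2 l ls : w \notin vs -> x \in vs -> y \in vs ->
  ends_in (predC1 w) ls ->
  ends l1 = normalize (x, w) -> ends l2 = normalize (w, y) -> ends l = normalize (x, y) ->
  absent l = (q * absent l1 * absent l2 + absent l1 * present l2 + present l1 * absent l2)%C ->
  present l = (present l1 * present l2)%C ->
  Zsum (w :: vs) id (l1 :: l2 :: ls) = Zsum vs id (l :: ls).
Proof.
move=> wvs xvs yvs wls e1 e2 e aE bE.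
have sub : {subset vs <= predC1 w} by move=> z zs; apply: contraNneq wvs => <-.
have xw : x != w by apply: sub.
have yw : y != w by apply: sub.
rewrite (Zsum_cons _ _ _ e1) !(Zsum_cons _ _ _ e2) (Zsum_cons _ _ _ e) aE bE.
rewrite (Zsum_isolated wvs wls); last by [].
(* This contraction renames [y] to [w], but away from [w] its kernel is still trivial. *)
have -> : Zsum (w :: vs) (contract id (w, y)) ls = Zsum vs id ls.
  rewrite (@Zsum_attached _ _ _ _ y) //; last by apply/esym; exact: (contract_ends id (w, y)).
  apply: Zsum_agree sub wls _ => u v; rewrite !inE => uw vw.
  by rewrite contract_eq /= (negbTE uw) (negbTE vw) !(andbF, andFb, orbF).
have -> : Zsum (w :: vs) (contract id (x, w)) ls = Zsum vs id ls.
  rewrite (@Zsum_attached _ _ _ _ x) //; last exact: (contract_ends id (x, w)).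
  apply: Zsum_agree sub wls _ => u v; rewrite !inE => uw vw.
  by rewrite contract_eq /= (negbTE uw) (negbTE vw) !(andbF, andFb, orbF).
have -> : Zsum (w :: vs) (contract (contract id (x, w)) (w, y)) ls = Zsum vs (contract id (x, y)) ls.
  rewrite (@Zsum_attached _ _ _ _ x) //; last by apply: contract_coarser; exact: (contract_ends id (x, w)).
  apply: Zsum_agree sub wls _ => u v; rewrite !inE => uw vw.
  by rewrite /contract /= eqxx (negbTE uw) (negbTE vw) (negbTE yw).
ring.
Qed.
End WeightedZ.

(** * Paths and forests *)

(** Routes are kept as edge sets that connect two vertices, which compose without care for
    repetitions; a simple path is extracted only where the flow bound or acyclicity is applied. *)
Definition linked (G : mgraph) (s : seq nat) : nat -> nat -> Prop :=
  clos_refl_sym_trans nat (fun u w => exists2 i, i \in s & joins G i u w).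

Lemma joinsC G i u w : joins G i u w = joins G i w u.
Proof. by rewrite /joins orbC. Qed.

Lemma joins_ends G i u w c d : joins G i u w -> joins G i c d -> u = c \/ u = d.
Proof.
move=> /andP[_ h] /andP[_ h'].
by case/orP: h => /andP[/eqP h1 /eqP h2]; case/orP: h' => /andP[/eqP h3 /eqP h4];
  rewrite -h3 -h4; auto.
Qed.

Lemma linked_sub G s s' x y : {subset s <= s'} -> linked G s x y -> linked G s' x y.
Proof.
move=> sub; elim=> {x y} [x y [i /sub si j]|x|x y _|x y z _ h1 _]; last exact: rst_trans.
- by apply: rst_step; exists i.
- exact: rst_refl.
- exact: rst_sym.
Qed.

Lemma linked_normalize G s x y :
  linked G s (normalize (x, y)).1 (normalize (x, y)).2 <-> linked G s x y.
Proof. by rewrite /normalize /=; case: leqP => _; split=> //; apply: rst_sym. Qed.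

Section Paths.
Variables (G : mgraph) (s : seq nat).

Let step (u w : nat) : bool := has (fun i => joins G i u w) s.
Let edge (u w : nat) : nat := nth 0 s (find (fun i => joins G i u w) s).

Let edge_mem u w : step u w -> edge u w \in s.
Proof. by rewrite /step has_find; apply: mem_nth. Qed.

Let edge_joins u w : step u w -> joins G (edge u w) u w.
Proof. exact: nth_find. Qed.

Lemma linked_path x y : linked G s x y -> exists2 p, path step x p & last x p = y.
Proof.
elim=> {x y} [x y [i si j]|x|x y _ [p px <-]|x y z _ [p px <-] _ [p' px' <-]].
- by exists [:: y] => //=; rewrite andbT; apply/hasP; exists i.
- by exists [::].
- exists (rev (belast x p)).
    rewrite rev_path (@eq_path _ _ step) // => u w.
    by apply: eq_has => i; apply: joinsC.
  by case: p {px} => //= a p; rewrite rev_cons last_rcons.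
- by exists (p ++ p'); rewrite ?cat_path ?px ?last_cat.
Qed.

(** The edges are distinct because the first one is incident to [x], while the later ones join
    vertices of the remaining path, which avoids [x]. *)
Let simple_path_edges x p : path step x p -> uniq (x :: p) ->
  [/\ walk_ok G (x :: p) (pairmap edge x p), {subset pairmap edge x p <= s},
      {in pairmap edge x p, forall i, exists c d, [/\ c \in x :: p, d \in x :: p & joins G i c d]} &
      uniq (pairmap edge x p)].
Proof.
elim: p x => [|a p IH] x; first by [].
rewrite [path _ _ _]/= => /andP[xa ap] /[dup] u /= /andP[xp up].
have [h1 h2 h3 h4] := IH a ap up.
split.
- by rewrite edge_joins.
- by move=> i; rewrite inE => /orP[/eqP ->|/h2]; [apply: edge_mem |].
- move=> i; rewrite inE => /orP[/eqP ->|/h3 [c [d [cp dp j]]]].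
    by exists x, a; rewrite !inE !eqxx orbT; split=> //; apply: edge_joins.
  by exists c, d; rewrite ![_ \in x :: _]inE cp dp !orbT.
- rewrite h4 andbT; apply/negP => /h3 [c [d [cp dp j]]].
  by case: (joins_ends (edge_joins xa) j) => e; move: xp; rewrite e ?cp ?dp.
Qed.

Lemma linked_simple_walk x y : linked G s x y -> exists p es,
  [/\ last x p = y, uniq (x :: p), walk_ok G (x :: p) es, {subset es <= s} & uniq es].
Proof.
case/linked_path => p0 px; case/shortenP: px => p px up _ <-.
by have [h1 h2 _ h4] := simple_path_edges px up; exists p, (pairmap edge x p).
Qed.

End Paths.

Lemma linked_is_path G s x y : linked G s x y -> exists vs es,
  [/\ is_path G x y vs es, {subset es <= s} & uniq es].
Proof.
case/linked_simple_walk => p [es [h1 h2 h3 h4 h5]]; exists (x :: p), es; split=> //.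
by apply/and4P; split=> //=; rewrite ?h1.
Qed.

(** Each set contains the edges of some path, and these paths inherit disjointness from the sets. *)
Lemma maxmaxflow_linked G L x y (Ts : seq (seq nat)) : maxmaxflow_le G L ->
  x < nv G -> y < nv G -> x != y -> uniq (flatten Ts) ->
  {in Ts, forall s, linked G s x y} -> size Ts <= L.
Proof.
move=> mm xn yn xy uT lT.
have [ps [<- aps sub ups]] : exists ps : seq (seq nat * seq nat),
  [/\ size ps = size Ts, all (fun p => is_path G x y p.1 p.2) ps,
      {subset flatten (map snd ps) <= flatten Ts} & uniq (flatten (map snd ps))].
  elim: Ts uT lT => [|T Ts IH] /=; first by exists [::].
  rewrite cat_uniq => /and3P[uT dT uTs] lT.
  have [|ps [e aps sub ups]] := IH uTs; first by move=> s sT; apply: lT; rewrite inE sT orbT.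
  have [vs [es [p1 p2 p3]]] := linked_is_path (lT T (mem_head _ _)).
  exists ((vs, es) :: ps); split=> /=; rewrite ?e ?p1 //.
    by move=> i; rewrite !mem_cat => /orP[/p2 ->|/sub ->]; rewrite ?orbT.
  rewrite cat_uniq p3 ups andbT; apply: contra dT => /hasP[i /sub h1 /p2 h2].
  by apply/hasP; exists i.
exact: mm aps ups.
Qed.

Lemma walk_ok_rcons G x p es i z : walk_ok G (x :: p) es -> joins G i (last x p) z ->
  walk_ok G (rcons (x :: p) z) (rcons es i).
Proof.
elim: p x es => [|a p IH] x [|j es] //=; first by move=> _ ->.
by move=> /andP[-> h] h'; apply: IH.
Qed.

(** A simple walk through earlier edges would be closed to a cycle by edge [i], which differs from
    all of them by its number. *)
Lemma forest_unlinked G i : forest G -> i < ne G ->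
  ~ linked G (iota 0 i) (nth (0, 0) (edges G) i).1 (nth (0, 0) (edges G) i).2.
Proof.
move=> fG iG /linked_simple_walk [p [es [lp up wp sub ues]]].
set e := nth _ _ _ in lp up wp; apply/negP: (fG (e.1 :: p) (rcons es i)).
rewrite /is_cycle up size_rcons rcons_uniq ues !andbT.
rewrite walk_ok_rcons //=; last by rewrite lp /joins iG -/e !eqxx orbT.
by rewrite negbK; apply/negP => /sub; rewrite mem_iota ltnn andbF.
Qed.

Lemma size_undup_contract r u w (vs : seq nat) : r u != r w -> u \in vs -> w \in vs ->
  size (undup (map r vs)) = (size (undup (map (contract r (u, w)) vs))).+1.
Proof.
move=> uw us ws.
suff /perm_size -> : perm_eq (undup (map r vs)) (r w :: undup (map (contract r (u, w)) vs)) by [].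
apply: uniq_perm; rewrite ?undup_uniq //=.
  rewrite undup_uniq andbT mem_undup; apply/mapP => -[x _]; rewrite /contract /=.
  by case: eqP => [_ /eqP|h /esym //]; rewrite eq_sym (negbTE uw).
move=> z; rewrite inE !mem_undup; apply/mapP/orP => [[x xs ->]|[/eqP ->|/mapP[x xs ->]]].
- case: (altP (r x =P r w)) => h; [by left | right; apply/mapP; exists x => //].
  by rewrite /contract /= (negbTE h).
- by exists w.
- by rewrite /contract /=; case: ifP => _; [exists u | exists x].
Qed.

(** Each edge of a forest merges two distinct classes and so contributes [a + b / q]; the factor
    [q ^ size ls] avoids the division. The invariant on [r], that identified vertices are linked by
    the first [k] edges, survives both deletion and contraction. *)
Lemma Zsum_forest q G (f : nat -> nat) ls k r : wf_graph G -> forest G ->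
  map ends ls = [seq normalize (f e.1, f e.2) | e <- drop k (edges G)] ->
  (forall x y, x < nv G -> y < nv G -> r (f x) = r (f y) -> linked G (iota 0 k) x y) ->
  let vs := map f (iota 0 (nv G)) in
  (Zsum q vs r ls * q ^ size ls =
   q ^ size (undup (map r vs)) * foldr (fun l p => (q * absent l + present l) * p) 1%R ls)%C.
Proof.
move=> wf fG eqs rl vs; elim: ls k r eqs rl => [|l ls IH] k r eqs rl; first by [].
have kG : k < size (edges G).
  by rewrite ltnNge; apply/negP => /drop_oversize e; move: eqs; rewrite e.
move: eqs; rewrite (drop_nth (0, 0) kG) /= => -[el els].
set e := nth _ _ _ in el.
have /andP[e1 e2] : (e.1 < nv G) && (e.2 < nv G) by apply: (allP wf); apply: mem_nth.
have nl := forest_unlinked fG kG.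
have re : r (f e.1) != r (f e.2) by apply/eqP => /(rl _ _ e1 e2).
have i1 : f e.1 \in vs by apply: map_f; rewrite mem_iota.
have i2 : f e.2 \in vs by apply: map_f; rewrite mem_iota.
have sub : {subset iota 0 k <= iota 0 k.+1} by move=> i; rewrite !mem_iota /= => /ltnW.
have je : linked G (iota 0 k.+1) e.1 e.2.
  by apply: rst_step; exists k; rewrite ?mem_iota //= /joins -/e kG !eqxx.
have rl' x y : x < nv G -> y < nv G -> r (f x) = r (f y) -> linked G (iota 0 k.+1) x y.
  by move=> xG yG /(rl _ _ xG yG); apply: linked_sub.
have h1 := IH k.+1 r els rl'.
have h2 := IH k.+1 (contract r (f e.1, f e.2)) els.
rewrite -/(Zsum q vs r (l :: ls)) (Zsum_cons _ _ _ _ el) (size_undup_contract re i1 i2) in h1 *.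
rewrite !Cpow_S in h1 *.
transitivity (q * (absent l * (Zsum q vs r ls * q ^ size ls) +
  present l * (Zsum q vs (contract r (f e.1, f e.2)) ls * q ^ size ls)))%C; first ring.
rewrite h1 h2; first by move: (foldr _ _ ls) (Cpow q (size _)) => p k'; ring.
move=> x y xG yG /eqP; rewrite contract_eq /=.
case/or3P => [/eqP/(rl' _ _ xG yG)//||] /andP[/eqP/rl' h /eqP/rl' h'].
  by apply: rst_trans (h xG e1) (rst_trans _ _ _ _ _ je (rst_sym _ _ _ _ (h' yG e2))).
exact: rst_trans (h xG e2) (rst_trans _ _ _ _ _ (rst_sym _ _ _ _ je) (rst_sym _ _ _ _ (h' yG e1))).
Qed.

(** * Series-parallel reduction *)

Lemma sp_wf_loopless G : series_parallel G -> wf_graph G && loopless G.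
Proof.
elim=> {G} [G -> -> //|G i _ /andP[wf ll] iG|G i _ /andP[wf ll] iG|G H _ /andP[wf ll] [nGH [f [fH [fI pH]]]]].
- have ei : nth (0, 0) (edges G) i \in edges G by apply: mem_nth.
  have /= /andP[e1 e2] := allP wf _ ei.
  have mem e : e \in edges (subdivide G i) ->
      [\/ e \in edges G, e = ((nth (0, 0) (edges G) i).1, nv G) | e = (nv G, (nth (0, 0) (edges G) i).2)].
    rewrite /= mem_rcons inE => /orP[/eqP ->|]; first by constructor 3.
    rewrite set_nthE iG mem_cat inE => /or3P[/mem_take h|/eqP ->|/mem_drop h].
    + by constructor 1.
    + by constructor 2.
    + by constructor 1.
  apply/andP; split; apply/allP => e /mem [eG|->|->] /=; rewrite ?ltnS ?leqnn ?e1 ?e2 ?(ltnW e1) ?(ltnW e2) //.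
  + by have /= /andP[h1 h2] := allP wf _ eG; rewrite (ltnW h1) (ltnW h2).
  + exact: (allP ll _ eG).
  + by rewrite ltn_eqF.
  + by rewrite gtn_eqF.
- have ei : nth (0, 0) (edges G) i \in edges G by apply: mem_nth.
  by rewrite /wf_graph /loopless /= !all_rcons (allP wf _ ei) (allP ll _ ei) [all _ _]wf [all _ _]ll.
- suff h e : e \in edges H -> [&& e.1 < nv H, e.2 < nv H & e.1 != e.2].
    by apply/andP; split; apply/allP => e /h /and3P[h1 h2 h3] //; rewrite h1 h2.
  move=> eH; have : normalize e \in map normalize (edges H) by apply: map_f.
  rewrite -(perm_mem pH) => /mapP[d dG]; have /= /andP[d1 d2] := allP wf _ dG.
  have d12 : f d.1 != f d.2 by apply: contra (allP ll _ dG) => /eqP /(fI _ _ d1 d2) ->.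
  have := fH _ d1; have := fH _ d2; move: d12; rewrite /normalize /=.
  case: e {eH} => a b /=.
  by case: (leqP a b) => _; case: (leqP (f d.1) (f d.2)) => _ h h1 h2 [-> ->]; rewrite ?h1 ?h2 ?h // eq_sym h.
Qed.

Section Reduction.
Variables (q : C) (n : nat) (G0 : mgraph).
Hypothesis n_gt0 : 0 < n.
Hypothesis rho_ge : (INR n <= Cmod (q - 1%R)%C * ln 2)%R.
Hypothesis flow_le : maxmaxflow_le G0 n.+1.

Definition route_edges (ls : seq wedge) : seq nat :=
  flatten [seq flatten (routes l) | l <- ls].

(** The premise of the last clause says that the edge lies on a cycle. A bridge has to satisfy only
    the first three clauses, the third being what the forest product requires. *)
Definition good (l : wedge) (others : seq nat) : Prop :=
  [/\ routes l <> [::],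
      {in routes l, forall s, linked G0 s (ends l).1 (ends l).2},
      (q * absent l + present l)%C <> 0%R &
      linked G0 others (ends l).1 (ends l).2 ->
        parallel_pieces q (size (routes l)) (absent l) (present l)].

(** The permutation singles out each edge in turn, with [rest] as its surroundings. *)
Definition reduced (ls : seq wedge) : Prop :=
  uniq (route_edges ls) /\
  forall l rest, Permutation ls (l :: rest) -> good l (route_edges rest).

Lemma good_sub l s s' : {subset s' <= s} -> good l s -> good l s'.
Proof. by move=> sub [h1 h2 h3 h4]; split=> // /(linked_sub sub). Qed.

Lemma perm_route_edges ls ls' : Permutation ls ls' -> perm_eq (route_edges ls) (route_edges ls').
Proof.
elim=> {ls ls'} [|l s s' _ IH|l l' s|s s' s'' _ IH1 _ IH2] //.
- by rewrite /route_edges /= perm_cat2l.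
- by rewrite /route_edges /= perm_catCA.
- exact: perm_trans IH1 IH2.
Qed.

Lemma reduced_Permutation ls ls' : Permutation ls ls' -> reduced ls -> reduced ls'.
Proof.
move=> p [u h]; split; first by rewrite -(perm_uniq (perm_route_edges p)).
by move=> l rest /(Permutation_trans p); apply: h.
Qed.

(** The merged edge uses exactly the original edges used by [l1] and [l2], so the surroundings of
    every other edge keep the same edge set and only [l] has to be checked. *)
Lemma reduced_merge l1 l2 l ls : reduced (l1 :: l2 :: ls) ->
  perm_eq (flatten (routes l)) (flatten (routes l1) ++ flatten (routes l2)) ->
  good l (route_edges ls) -> reduced (l :: ls).
Proof.
move=> [u h] pl gl.
have ps s : perm_eq (route_edges (l :: s)) (route_edges (l1 :: l2 :: s)).
  by rewrite /route_edges /= catA perm_cat2r.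
split; first by rewrite (perm_uniq (ps ls)).
move=> m rest p; have := Permutation_in m (Permutation_sym p) (or_introl erefl).
case=> [lm|/(@List.in_split _ m _) [s1 [s2 els]]].
  rewrite -lm in p *; have /perm_route_edges p' := Permutation_cons_inv p.
  by apply: good_sub gl => i; rewrite (perm_mem p').
have pm : Permutation (l1 :: l2 :: ls) (m :: l1 :: l2 :: s1 ++ s2).
  rewrite els; apply: Permutation_sym; exact: (Permutation_middle (l1 :: l2 :: s1) s2 m).
apply: good_sub (h _ _ pm) => i; rewrite -(perm_mem (ps _)).
have /perm_route_edges/perm_mem -> // : Permutation rest (l :: s1 ++ s2).
apply: (@Permutation_cons_inv _ _ _ m); apply: Permutation_trans (Permutation_sym p) _.
rewrite els; apply: Permutation_sym; exact: (Permutation_middle (l :: s1) s2 m).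
Qed.

Lemma good_linked l others ls : good l others ->
  linked G0 (route_edges (l :: ls)) (ends l).1 (ends l).2.
Proof.
case; case er : (routes l) => [//|s Ts] _ /(_ s (mem_head _ _)) h _ _.
by apply: linked_sub h => i si; rewrite /route_edges /= er /= !mem_cat si.
Qed.

Lemma reduced_series x w y l1 l2 ls : reduced (l1 :: l2 :: ls) ->
  x < nv G0 -> w < nv G0 -> y < nv G0 -> x != w -> w != y ->
  ends l1 = normalize (x, w) -> ends l2 = normalize (w, y) ->
  reduced (WEdge (normalize (x, y))
    (q * absent l1 * absent l2 + absent l1 * present l2 + present l1 * absent l2)
    (present l1 * present l2) [:: flatten (routes l1) ++ flatten (routes l2)] :: ls).
Proof.
move=> red xG wG yG xw wy e1 e2; apply: (reduced_merge red); first by rewrite /= cats0.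
have [u h] := red.
have g1 := h _ _ (Permutation_refl _); have g2 := h _ _ (perm_swap _ _ _).
have [r1 k1 d1 p1] := g1; have [r2 k2 d2 p2] := g2.
have lk1 := good_linked [::] g1; have lk2 := good_linked [::] g2.
rewrite e1 in k1 lk1 p1; rewrite e2 in k2 lk2 p2.
move/linked_normalize in lk1; move/linked_normalize in lk2.
rewrite /route_edges /= cats0 in lk1; rewrite /route_edges /= cats0 in lk2.
split=> //=.
- move=> s; rewrite inE => /eqP ->; apply/(linked_normalize G0 _ x y).
  apply: rst_trans (linked_sub _ lk1) (linked_sub _ lk2) => i si; by rewrite mem_cat si ?orbT.
- have -> : (q * (q * absent l1 * absent l2 + absent l1 * present l2 + present l1 * absent l2) + present l1 * present l2 = (q * absent l1 + present l1) * (q * absent l2 + present l2))%C by ring.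
  exact: Cmult_neq_0.
move=> /(linked_normalize G0 _ x y) lk.
(* A cycle through the new edge passes through both halves, so each half has its ends linked by the
   other half together with the rest. *)
have c1 : linked G0 (route_edges (l2 :: ls)) x w.
  apply: rst_trans (linked_sub _ lk) (rst_sym _ _ _ _ (linked_sub _ lk2)) => i si;
    by rewrite /route_edges /= mem_cat si ?orbT.
have c2 : linked G0 (route_edges (l1 :: ls)) w y.
  apply: rst_trans (rst_sym _ _ _ _ (linked_sub _ lk1)) (linked_sub _ lk) => i si;
    by rewrite /route_edges /= mem_cat si ?orbT.
apply: (parallel_pieces_series n_gt0 rho_ge) => //.
- apply: (parallel_pieces_bound n_gt0 rho_ge) (p1 _); last by apply/linked_normalize.
  (* The surroundings supply one route besides those of [l1], so the flow bound [n.+1] leaves at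
     most [n] for [l1]. *)
  rewrite -ltnS; apply: (@maxmaxflow_linked _ _ x w (route_edges (l2 :: ls) :: routes l1) flow_le) => //.
    by rewrite /= uniq_catC.
  by move=> s; rewrite inE => /orP[/eqP -> //|/k1]; move/linked_normalize.
- apply: (parallel_pieces_bound n_gt0 rho_ge) (p2 _); last by apply/linked_normalize.
  rewrite -ltnS; apply: (@maxmaxflow_linked _ _ w y (route_edges (l1 :: ls) :: routes l2) flow_le) => //.
    by rewrite -(perm_uniq (perm_route_edges (perm_swap _ _ _))) /route_edges /= uniq_catC in u.
  by move=> s; rewrite inE => /orP[/eqP -> //|/k2]; move/linked_normalize.
Qed.

(** Each of the two edges closes a cycle with the other, so both are known to be made of parallel
    pieces. Their routes together number at most [n.+1], which suffices for the denominator even if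
    the result is a bridge. *)
Lemma reduced_parallel x y l1 l2 ls : reduced (l1 :: l2 :: ls) ->
  x < nv G0 -> y < nv G0 -> x != y ->
  ends l1 = normalize (x, y) -> ends l2 = normalize (x, y) ->
  reduced (WEdge (normalize (x, y)) (absent l1 * absent l2)
    (absent l1 * present l2 + present l1 * absent l2 + present l1 * present l2)
    (routes l1 ++ routes l2) :: ls).
Proof.
move=> red xG yG xy e1 e2; apply: (reduced_merge red); first by rewrite /= flatten_cat.
have [u h] := red.
have g1 := h _ _ (Permutation_refl _); have g2 := h _ _ (perm_swap _ _ _).
have [r1 k1 d1 p1] := g1; have [r2 k2 d2 p2] := g2.
have := p1; rewrite e1 -e2 => /(_ (good_linked _ g2)) {}p1.
have := p2; rewrite e2 -e1 => /(_ (good_linked _ g1)) {}p2.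
have p := parallel_pieces_mul n_gt0 rho_ge p1 p2.
split=> /=.
- by case: (routes l1) r1.
- by move=> s; rewrite mem_cat => /orP[/k1|/k2]; rewrite ?e1 ?e2.
- apply: (parallel_pieces_denominator n_gt0 rho_ge _ p); rewrite -size_cat.
  apply: (@maxmaxflow_linked _ _ x y _ flow_le) => //.
    by move: u; rewrite /route_edges /= catA cat_uniq flatten_cat => /andP[].
  by move=> s; rewrite mem_cat => /orP[/k1|/k2]; rewrite ?e1 ?e2 => /linked_normalize.
- by rewrite size_cat.
Qed.

Lemma map_eq_cat (A B : Type) (f : A -> B) s t1 t2 : map f s = t1 ++ t2 ->
  exists s1 s2, [/\ s = s1 ++ s2, map f s1 = t1 & map f s2 = t2].
Proof.
move=> e; exists (take (size t1) s), (drop (size t1) s).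
by rewrite cat_take_drop map_take map_drop e take_size_cat // drop_size_cat.
Qed.

Lemma map_eq_cons (A B : Type) (f : A -> B) s b t : map f s = b :: t ->
  exists a s', [/\ s = a :: s', f a = b & map f s' = t].
Proof. by case: s => // a s [<- <-]; exists a, s. Qed.

Lemma normalize_map (f : nat -> nat) e :
  normalize (f (normalize e).1, f (normalize e).2) = normalize (f e.1, f e.2).
Proof. by rewrite /normalize /=; case: (leqP e.1 e.2) => _ //; rewrite minnC maxnC. Qed.

Lemma perm_eq_Permutation (T : eqType) (s t : seq T) : perm_eq s t -> Permutation s t.
Proof.
elim: s t => [|x s IH] t p.
  by move/perm_size: p; case: t.
have xt : x \in t by rewrite -(perm_mem p) mem_head.
case/splitPr: xt p => t1 t2; rewrite perm_sym -[x :: t2]cat1s perm_catCA /= perm_cons perm_sym => /IH p.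
exact: Permutation_trans (perm_skip x p) (Permutation_middle t1 t2 x).
Qed.

Lemma Permutation_pull (T : Type) (x : T) s t : Permutation (x :: s ++ t) (s ++ x :: t).
Proof. exact: Permutation_middle. Qed.

Lemma Permutation_pull2 (T : Type) (x y : T) s t :
  Permutation (s ++ x :: t ++ [:: y]) (x :: y :: s ++ t).
Proof.
apply: Permutation_trans (Permutation_sym (Permutation_pull _ _ _)) _.
by apply: perm_skip; rewrite catA -[s ++ t in X in Permutation _ X]cats0; apply: Permutation_sym (Permutation_pull _ _ _).
Qed.

(** The induction undoes the last operation that built [G]. The injection [f] places the vertices of
    the current graph in [G0], since routes and the flow bound always refer to [G0] while
    isomorphisms relabel [G]. *)
Lemma reduced_Zsum_neq0 G (f : nat -> nat) ls : series_parallel G ->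
  {in gtn (nv G) &, injective f} -> {in gtn (nv G), forall x, f x < nv G0} ->
  map ends ls = [seq normalize (f e.1, f e.2) | e <- edges G] -> reduced ls ->
  Zsum q (map f (iota 0 (nv G))) id ls <> 0%R.
Proof.
move=> sp; elim: sp f ls => {G} [G wf _ fG|G i spG IH iG|G i spG IH iG|G H spG IH isoGH] f ls fI fG0 els red.
- have ker x y : x < nv G -> y < nv G -> f x = f y -> linked G (iota 0 0) x y.
    by move=> xG yG e; rewrite (fI x y xG yG e); apply: rst_refl.
  move=> z0; have := @Zsum_forest q G f ls 0 id wf fG; rewrite drop0 => /(_ els ker) /=.
  rewrite z0 Cmult_0_l => /esym; apply: Cmult_neq_0; first exact: Cpow_nz (q_neq0 n_gt0 rho_ge).
  have : forall l rest, Permutation ls (l :: rest) -> (q * absent l + present l)%C <> 0%R.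
    by move=> l rest /(proj2 red) [].
  elim: (ls) => [_ /RtoC_inj|l s IH h /=]; first lra.
  apply: Cmult_neq_0; first exact: (h l s).
  by apply: IH => m rest p; apply: (h m (l :: rest)); apply: Permutation_trans (perm_skip l p) (perm_swap _ _ _).
- move: els fI fG0; rewrite /subdivide /= set_nthE iG; set e := nth _ _ _; set N := nv G => els fI fG0.
  have /andP[wf ll] := sp_wf_loopless spG.
  have eG : e \in edges G by apply: mem_nth.
  have /= /andP[e1 e2] := allP wf _ eG; have /= e12 := allP ll _ eG.
  have fI' : {in gtn N &, injective f} by move=> x y /ltnW xN /ltnW yN; apply: fI.
  have fG0' : {in gtn N, forall x, f x < nv G0} by move=> x /ltnW xN; apply: fG0.
  have xG := fG0' _ e1; have yG := fG0' _ e2; have wG := fG0 N (ltnSn N).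
  have xw : f e.1 != f N by apply: contraTneq (e1) => /(fI e.1 N (ltnW e1) (ltnSn N)) ->; rewrite ltnn.
  have wy : f N != f e.2 by apply: contraTneq (e2) => /(fI N e.2 (ltnSn N) (ltnW e2)) <-; rewrite ltnn.
  (* The list [ls] is cut along the edge list: [l1] stands at position [i], where one half replaced
     the old edge, and [l2] at the end, where the other half was appended. *)
  move: els; rewrite -cats1 -catA map_cat /= => els.
  have [s1 [s2' [E1 els1 els']]] := map_eq_cat els.
  have [l1 [s2 [E2 el1 els2']]] := map_eq_cons els'.
  move: els2'; rewrite map_cat => els2'.
  have [s3 [s4 [E3 els3 els4]]] := map_eq_cat els2'.
  have [l2 [s5 [E4 el2 els5]]] := map_eq_cons els4.
  case: s5 E4 els5 => // E4 _; rewrite {}E4 in E3; rewrite {}E3 in E2; rewrite {}E2 in E1.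
  have pls : Permutation ls (l1 :: l2 :: s1 ++ s3) by rewrite E1; apply: Permutation_pull2.
  pose l := WEdge (normalize (f e.1, f e.2))
    (q * absent l1 * absent l2 + absent l1 * present l2 + present l1 * absent l2)
    (present l1 * present l2) [:: flatten (routes l1) ++ flatten (routes l2)].
  have pl : Permutation (l :: s1 ++ s3) (s1 ++ l :: s3) := Permutation_pull _ _ _.
  have red' : reduced (s1 ++ l :: s3).
    apply: reduced_Permutation pl _.
    exact: reduced_series (reduced_Permutation pls red) xG wG yG xw wy el1 el2.
  have elsG : map ends (s1 ++ l :: s3) = [seq normalize (f e.1, f e.2) | e <- edges G].
    by rewrite -(cat_take_drop i (edges G)) (drop_nth (0, 0) iG) -/e !map_cat /= els1 els3.
  have pv : perm_eq (map f (iota 0 N.+1)) (f N :: map f (iota 0 N)).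
    by rewrite -addn1 iotaD map_cat /= cats1 perm_rcons.
  have wvs : f N \notin map f (iota 0 N).
    apply/mapP => -[z]; rewrite mem_iota => /= zN.
    by move=> /(fI N z (ltnSn N) (ltnW zN)) h; rewrite -h ltnn in zN.
  have fvs z : z < N -> f z \in map f (iota 0 N) by move=> zN; apply: map_f; rewrite mem_iota.
  have ein : ends_in (predC1 (f N)) (s1 ++ s3).
    have ein d : d \in edges G -> ((normalize (f d.1, f d.2)).1 != f N) && ((normalize (f d.1, f d.2)).2 != f N).
      move=> /(allP wf)/andP[/fvs d1 /fvs d2].
      have {}d1 : f d.1 != f N by apply: contraNneq wvs => <-.
      have {}d2 : f d.2 != f N by apply: contraNneq wvs => <-.
      by rewrite /normalize /=; case: leqP => _; rewrite d1 d2.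
    have : all (fun p => (p.1 != f N) && (p.2 != f N)) (map ends (s1 ++ s3)).
      rewrite map_cat els1 els3 -map_cat all_map; apply/allP => d.
      rewrite mem_cat => /orP[/mem_take|/mem_drop] dG; exact: ein dG.
    by rewrite all_map.
  rewrite (Zsum_perm_vertices _ _ _ pv) (Zsum_Permutation _ _ _ pls).
  rewrite (@Zsum_series _ _ _ _ _ _ _ l _ wvs (fvs _ e1) (fvs _ e2) ein el1 el2) //.
  by rewrite (Zsum_Permutation _ _ _ pl); apply: IH.
- move: els; rewrite /duplicate /=; set e := nth _ _ _ => els.
  have /andP[wf ll] := sp_wf_loopless spG.
  have eG : e \in edges G by apply: mem_nth.
  have /= /andP[e1 e2] := allP wf _ eG; have /= e12 := allP ll _ eG.
  have xG := fG0 _ e1; have yG := fG0 _ e2.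
  have xy : f e.1 != f e.2 by apply: contraNneq e12 => /(fI e.1 e.2 e1 e2) ->.
  move: els; rewrite -cats1 map_cat -{1}(cat_take_drop i (edges G)) (drop_nth (0, 0) iG) -/e map_cat -catA /= => els.
  have [s1 [s2' [E1 els1 els']]] := map_eq_cat els.
  have [l1 [s2 [E2 el1 els2']]] := map_eq_cons els'.
  have [s3 [s4 [E3 els3 els4]]] := map_eq_cat els2'.
  have [l2 [s5 [E4 el2 els5]]] := map_eq_cons els4.
  case: s5 E4 els5 => // E4 _; rewrite {}E4 in E3; rewrite {}E3 in E2; rewrite {}E2 in E1.
  have pls : Permutation ls (l1 :: l2 :: s1 ++ s3) by rewrite E1; apply: Permutation_pull2.
  pose l := WEdge (normalize (f e.1, f e.2)) (absent l1 * absent l2)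
    (absent l1 * present l2 + present l1 * absent l2 + present l1 * present l2)
    (routes l1 ++ routes l2).
  have pl : Permutation (l :: s1 ++ s3) (s1 ++ l :: s3) := Permutation_pull _ _ _.
  have red' : reduced (s1 ++ l :: s3).
    apply: reduced_Permutation pl _.
    exact: reduced_parallel (reduced_Permutation pls red) xG yG xy el1 el2.
  have elsG : map ends (s1 ++ l :: s3) = [seq normalize (f e.1, f e.2) | e <- edges G].
    by rewrite -(cat_take_drop i (edges G)) (drop_nth (0, 0) iG) -/e !map_cat /= els1 els3.
  rewrite (Zsum_Permutation _ _ _ pls) (@Zsum_parallel _ _ _ _ _ l) ?el1 ?el2 //.
  by rewrite (Zsum_Permutation _ _ _ pl); apply: IH.
- case: isoGH => nGH [g [gH [gI pg]]].
  have pe : perm_eq (map ends ls) [seq normalize (f (g e.1), f (g e.2)) | e <- edges G].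
    have nm (h : nat -> nat) s : [seq normalize (f e.1, f e.2) | e <- [seq normalize (h e.1, h e.2) | e <- s]] =
        [seq normalize (f (h e.1), f (h e.2)) | e <- s].
      by rewrite -map_comp; apply: eq_map => e; apply: (normalize_map f (h e.1, h e.2)).
    rewrite els -nm -(nm id) perm_sym; exact: perm_map pg.
  have [ls' [els' pls]] := Permutation_map_inv _ _ (Permutation_sym (perm_eq_Permutation pe)).
  (* An injection between vertex sets of equal size is onto. *)
  have pv : perm_eq (map g (iota 0 (nv G))) (iota 0 (nv H)).
    have u : uniq (map g (iota 0 (nv G))).
      rewrite map_inj_in_uniq ?iota_uniq // => x y; rewrite !mem_iota /= => xG yG.
      exact: gI.
    have sub : {subset map g (iota 0 (nv G)) <= iota 0 (nv H)}.
      by move=> _ /mapP[x xG ->]; rewrite !mem_iota /= in xG *; apply: gH.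
    have [|_ h] := uniq_min_size u sub; first by rewrite size_map !size_iota nGH.
    exact: uniq_perm u (iota_uniq _ _) h.
  rewrite (Zsum_Permutation _ _ _ pls) -(Zsum_perm_vertices _ _ _ (perm_map f pv)) -map_comp.
  apply: IH; last exact: reduced_Permutation pls red.
  + by move=> x y xG yG /= /(fI _ _ (gH _ xG) (gH _ yG)); apply: gI.
  + by move=> x xG; apply/fG0/gH.
  + exact: esym els'.
Qed.
End Reduction.

(** * The chromatic polynomial *)

(* From here on [Cmod] and [Cpow] are those of [Defs], not Coquelicot's. *)
Import Defs.

Lemma Cadd_assoc : associative Cadd.
Proof. by move=> [a b] [c d] [e f]; rewrite /Cadd /=; f_equal; ring. Qed.

Lemma Cadd_comm : commutative Cadd.
Proof. by move=> [a b] [c d]; rewrite /Cadd /=; f_equal; ring. Qed.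

Lemma Cadd_0l : left_id Czero Cadd.
Proof. by move=> [a b]; rewrite /Cadd /Czero /=; f_equal; ring. Qed.

HB.instance Definition _ := Monoid.isComLaw.Build Cx Czero Cadd Cadd_assoc Cadd_comm Cadd_0l.

Lemma CscaleE r z : Cscale r z = Cmult r z.
Proof. by case: z => a b; rewrite /Cscale /Cmult /=; f_equal; ring. Qed.

Lemma CpowE z k : Cpow z k = Complex.Cpow z k.
Proof. by elim: k => //= k ->. Qed.

Lemma CmodE z : Cmod z = Complex.Cmod z.
Proof. by rewrite /Cmod /Complex.Cmod /= !Rmult_1_r. Qed.

Definition edge_wedge (G : mgraph) (i : nat) : wedge :=
  WEdge (normalize (nth (0, 0) (edges G) i)) 1%R (- (1%R : C))%C [:: [:: i]].

Section Components.
Variables (G : mgraph).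
Hypothesis wf : wf_graph G.
Implicit Types A : {set 'I_(ne G)}.

Lemma adjA_sym A : connect_sym (adjA A).
Proof.
by apply: sym_connect_sym => x y; apply: eq_existsb => i; rewrite joinsC.
Qed.

(** The component root is extended by the identity outside the vertex range, because [Zsum] takes
    maps on [nat]. *)
Definition rep A (x : nat) : nat :=
  if insub x is Some x' then val (root (adjA A) (x' : 'I_(nv G))) else x.

Lemma rep_ord A (x : 'I_(nv G)) : rep A x = root (adjA A) x.
Proof. by rewrite /rep valK. Qed.

Lemma rep_eq A (x y : 'I_(nv G)) : (rep A x == rep A y) = connect (adjA A) x y.
Proof. by rewrite !rep_ord -(root_connect (adjA_sym A)). Qed.

Lemma ncompE A : ncomp A = size (undup (map (rep A) (iota 0 (nv G)))).
Proof.
pose h (x : 'I_(nv G)) := [set y | connect (adjA A) x y].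
have hr x : h (root (adjA A) x) = h x.
  by apply/setP => y; rewrite !inE (same_connect (adjA_sym A) (y := x)) // adjA_sym connect_root.
rewrite /ncomp -/h -val_enum_ord -map_comp.
rewrite (@eq_map _ _ _ (val \o root (adjA A))); last by move=> x /=; rewrite rep_ord.
rewrite map_comp (undup_map_inj val_inj) size_map.
have -> : [set h x | x : 'I_(nv G)] = h @: [set root (adjA A) x | x : 'I_(nv G)].
  by rewrite -imset_comp; apply: eq_imset => x /=; rewrite hr.
rewrite card_in_imset; last first.
  move=> _ _ /imsetP[x _ ->] /imsetP[y _ ->]; rewrite !hr => /setP/(_ y).
  by rewrite !inE connect0 => /(rootP (adjA_sym A)).
rewrite -(card_uniqP (undup_uniq _)); apply: eq_card => x.
rewrite mem_undup; apply/imsetP/mapP => [[y _ ->]|[y _ ->]]; exists y => //.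
by rewrite mem_enum.
Qed.

(** Along a path in the enlarged graph, a step through edge [i] joins two vertices that the
    contraction identifies, and every other step stays inside a class of [rep A]. *)
Lemma rep_setU1 (i : 'I_(ne G)) A :
  agree (gtn (nv G)) (rep (i |: A)) (contract (rep A) (nth (0, 0) (edges G) i)).
Proof.
move=> x y xG yG; set e := nth _ _ _.
have /= /andP[e1 e2] : (e.1 < nv G) && (e.2 < nv G) by apply: (allP wf); apply: mem_nth.
rewrite -[x]/(val (Ordinal xG)) -[y]/(val (Ordinal yG)) rep_eq.
move: (Ordinal xG) (Ordinal yG) => {xG yG} {}x {}y.
have mono : subrel (connect (adjA A)) (connect (adjA (i |: A))).
  apply: connect_sub => u v /existsP[k /andP[kA j]]; apply: connect1.
  by apply/existsP; exists k; rewrite inE kA orbT.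
have ce : connect (adjA (i |: A)) (Ordinal e1) (Ordinal e2).
  apply: connect1; apply/existsP; exists i.
  by rewrite !inE eqxx /joins ltn_ord -/e !eqxx.
apply/idP/idP; last first.
  rewrite contract_eq -[e.1]/(val (Ordinal e1)) -[e.2]/(val (Ordinal e2)) !rep_eq.
  case/or3P => [/mono //|/andP[/mono h /mono h']|/andP[/mono h /mono h']].
    by rewrite adjA_sym in h'; apply: connect_trans h (connect_trans ce h').
  by rewrite adjA_sym in h'; rewrite adjA_sym in ce; apply: connect_trans h (connect_trans ce h').
case/connectP => p px ->; elim: p x px => [|a p IH] x //= /andP[/existsP[k /andP[kA j]] /IH].
move=> /eqP <-; move: kA; rewrite !inE => /orP[/eqP ki|kA].
  have := contract_ends (rep A) e; move: j; rewrite /joins ki ltn_ord -/e /=.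
  by case/orP => /andP[/eqP <- /eqP <-] ->.
apply/eqP/contract_coarser/eqP; rewrite rep_eq; apply: connect1.
by apply/existsP; exists k; rewrite kA.
Qed.

Lemma rep_set0 : agree (gtn (nv G)) (rep set0) id.
Proof.
move=> x y xG yG; rewrite -[x]/(val (Ordinal xG)) -[y]/(val (Ordinal yG)) rep_eq.
apply/idP/eqP => [/connectP[[|a p] /=]|e]; first by move=> _ [->].
  by case/andP => /existsP[k]; rewrite inE.
by have -> : Ordinal xG = Ordinal yG by apply: val_inj.
Qed.

Lemma chrom_Zsum q :
  chrom G q = Zsum q (iota 0 (nv G)) id [seq edge_wedge G i | i <- iota 0 (ne G)].
Proof.
set vs := iota _ _; set ls := map _ _.
have sub : {subset vs <= gtn (nv G)} by move=> x; rewrite mem_iota.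
have szl : size ls = ne G by rewrite size_map size_iota.
have ein j : ends_in (gtn (nv G)) (drop j ls).
  rewrite /ends_in -map_drop all_map; apply/allP => i /mem_drop; rewrite mem_iota /= => iG.
  have /andP[] : _ && _ := allP wf _ (mem_nth (0, 0) iG); set e := nth _ _ _ => e1 e2.
  by rewrite /normalize /= !inE; case: (leqP e.1 e.2) => _; rewrite e1 e2.
(* In [T j A] the edges before [j] are decided, with [A] the present ones, and the others are still
   expanded recursively. The sum over [A] does not depend on [j]; it is [Zsum] at [j = 0] and
   [chrom] at [j = ne G]. *)
pose T j A := Cscale (pow (Ropp R1) #|A|) (Zsum q vs (rep A) (drop j ls)).
pose below j A := A \subset [set i : 'I_(ne G) | i < j].
have T0 : \big[Cadd/Czero]_(A | below 0 A) T 0 A = Zsum q vs id ls.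
  rewrite (big_pred1 set0); last by move=> A; rewrite /below /= -subset0; congr (_ \subset _); apply/setP => i; rewrite !inE.
  by rewrite /T cards0 CscaleE drop0 (Zsum_agree _ sub _ rep_set0) ?Cmult_1_l // -[ls]drop0 ein.
have step j : j < ne G -> \big[Cadd/Czero]_(A | below j.+1 A) T j.+1 A = \big[Cadd/Czero]_(A | below j A) T j A.
  move=> jG; pose i := Ordinal jG.
  have iNb A : below j A -> i \notin A by move=> /subsetP b; apply/negP => /b; rewrite inE ltnn.
  (* Splitting on the presence of edge [j], and removing it from the sets that contain it, matches
     one deletion-contraction step. *)
  rewrite (bigID (fun A => i \in A)) /=.
  rewrite (reindex_onto (fun A => i |: A) (fun A => A :\ i)) /=; last by move=> A /andP[_ iA]; rewrite setD1K.
  rewrite Cadd_comm.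
  rewrite (eq_bigl (below j)); last first.
    move=> A; apply/andP/idP => [[/subsetP b iA]|b].
      apply/subsetP => k kA; have := b k kA; rewrite !inE ltnS leq_eqVlt => /orP[/eqP ki|//].
      by move: iA; rewrite (_ : i = k) ?kA //; apply: val_inj.
    split; last exact: iNb.
    by apply: subset_trans b _; apply/subsetP => k; rewrite !inE => /ltnW.
  rewrite [X in Cadd _ X](eq_bigl (below j)); last first.
    move=> A; rewrite setU11 andbT; apply/andP/idP => [[/subsetP b /eqP e]|b].
      have iA : i \notin A by rewrite -e !inE eqxx.
      apply/subsetP => k kA; have := b k (setU1r _ kA); rewrite !inE ltnS leq_eqVlt => /orP[/eqP ki|//].
      by move: iA; rewrite (_ : i = k) ?kA //; apply: val_inj.
    split; last by rewrite setU1K // iNb.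
    apply/subsetP => k; rewrite !inE => /orP[/eqP -> //=|kA].
    by have /subsetP/(_ k kA) := b; rewrite inE => /ltnW.
  rewrite -big_split; apply: eq_bigr => A bA.
  rewrite /T !CscaleE cardsU1 (iNb _ bA) [drop j ls](drop_nth (edge_wedge G 0)) ?szl //.
  rewrite [nth _ ls j](nth_map 0) ?size_iota // nth_iota // add0n.
  rewrite (@Zsum_cons _ _ _ _ _ (nth (0, 0) (edges G) j)) //.
  rewrite (Zsum_agree _ sub (ein _) (@rep_setU1 i A)) /=.
  rewrite RtoC_mult RtoC_opp add0n.
  have E (a b c : C) : (a * b + (- (1%R : C)) * a * c = a * (1%R * b + (- (1%R : C)) * c))%C by ring.
  exact: E.
have Tn : \big[Cadd/Czero]_(A | below (ne G) A) T (ne G) A = chrom G q.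
  rewrite /chrom; apply: eq_big => [A|A _]; first by apply/subsetP => i _; rewrite inE.
  by rewrite /T drop_oversize ?szl //= -ncompE CpowE.
rewrite -Tn -T0.
have all j : j <= ne G -> \big[Cadd/Czero]_(A | below j A) T j A = \big[Cadd/Czero]_(A | below 0 A) T 0 A.
  by elim: j => // j IH jG; rewrite step // IH // ltnW.
exact: all.
Qed.
End Components.

Theorem theorem1p4 (L : nat) (hL : 2 <= L) (G : mgraph) :
  wf_graph G -> loopless G -> series_parallel G -> maxmaxflow_le G L ->
  forall q : Cx, chrom G q = Czero ->
  Rlt (Cmod (Csub q Cone)) (Rdiv (Rminus (INR L) R1) (ln (INR 2))).
Proof.
move=> wf ll sp flow q; rewrite (chrom_Zsum wf) => z0.
(* From here on [L] is [n.+1], and [2 <= n.+1] is convertible to [0 < n]. *)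
case: L hL flow => // n n_gt0 flow.
apply: Rnot_le_lt => h; rewrite CmodE in h.
have rho_ge : (INR n <= Complex.Cmod (q - 1%R)%C * ln 2)%R.
  have [l1 _] := ln2_bounds.
  move: h; change (INR 2) with 2%R; rewrite S_INR => h.
  have := Rmult_le_compat_r (ln 2) _ _ ltac:(lra) h.
  rewrite (_ : ((INR n + 1 - R1) / ln 2 * ln 2)%R = INR n) //; field; lra.
set ls := map _ _ in z0.
have red : reduced q G ls.
  split.
    rewrite /route_edges /ls -map_comp (@eq_map _ _ _ (fun i => [:: i])) //.
    by rewrite flatten_map1 map_id iota_uniq.
  move=> l rest p.
  have [i iG ->] : exists2 i, i < ne G & l = edge_wedge G i.
    have : List.In l ls by apply: Permutation_in (Permutation_sym p) _; left.
    rewrite /ls; have : all (gtn (ne G)) (iota 0 (ne G)) by apply/allP => i; rewrite mem_iota.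
    elim: (iota 0 (ne G)) => //= i s IH /andP[iG /IH IHs] [<-|/IHs //].
    by exists i.
  have q1 : (q - 1%R)%C <> 0%R.
    by apply/Cmod_gt_0; have := rho_gt1 n_gt0 rho_ge; lra.
  split=> //=.
  - move=> s; rewrite inE => /eqP ->; apply: rst_step; exists i; rewrite ?mem_head //.
    by rewrite /joins iG /normalize /=; case: leqP => _; rewrite !eqxx ?orbT.
  - by rewrite (_ : (q * 1%R + - (1%R : C))%C = (q - 1%R)%C) //; ring.
  - by move=> _; apply: parallel_pieces_edge.
apply: (@reduced_Zsum_neq0 q n G n_gt0 rho_ge flow G id ls sp) => //.
  rewrite -map_comp -[edges G in RHS](mkseq_nth (0, 0)) /mkseq -map_comp; apply: eq_map => i /=.
  by rewrite -surjective_pairing.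
by rewrite map_id.
Qed.
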